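(* Consider the degree-2, rank-$r$ factorization machine model over features $V$ with parameters $\boldsymbol\theta$ consisting of $\theta_0\in\mathbb R$ and $\boldsymbol\theta_i,\boldsymbol\theta_i^{(\ell)}\in\mathbb R^{N_i}$ for $i\in V$, $\ell\in[r]$, and objective $$J(\boldsymbol\theta)=\frac1{2|D|}\sum_{(\mathbf x,y)\in D}\Big(\theta_0+\sum_{i\in V}\langle\boldsymbol\theta_i,\mathbf x_i\rangle+\sum_{\{i,j\}\in\binom V2}\Big\langle\sum_{\ell\in[r]}\boldsymbol\theta_i^{(\ell)}\otimes\boldsymbol\theta_j^{(\ell)},\mathbf x_i\otimes\mathbf x_j\Big\rangle-y\Big)^2+\frac\lambda2\|\boldsymbol\theta\|_2^2,$$ and $k$ groups of simple functional dependencies $G_i=\{f_i\}\cup S_i$, $i\in[k]$. Let $G=\bigcup_{i\in[k]}G_i$, $F=\{f_1,\dots,f_k\}$, $$\boldsymbol\beta_{f_i}=\sum_{\ell=1}^r\sum_{\{c,t\}\in\binom{G_i}2}\mathbf R_c^\top\boldsymbol\theta_c^{(\ell)}\circ\mathbf R_t^\top\boldsymbol\theta_t^{(\ell)},\qquad i\in[k],$$ and define the reparameterization $\gamma_0=\theta_0$, $$\boldsymbol\gamma_w=\begin{cases}\boldsymbol\theta_w,&w\in V\setminus G,\\ \boldsymbol\theta_{f_i}+\sum_{c\in S_i}\mathbf R_c^\top\boldsymbol\theta_c+\boldsymbol\beta_{f_i},&w=f_i,\ i\in[k],\end{cases}\qquad \boldsymbol\gamma_w^{(\ell)}=\begin{cases}\boldsymbol\theta_w^{(\ell)},&w\in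 V\setminus F,\\ \boldsymbol\theta_{f_i}^{(\ell)}+\sum_{c\in S_i}\mathbf R_c^\top\boldsymbol\theta_c^{(\ell)},&w=f_i,\ i\in[k].\end{cases}$$ Then minimizing $J(\boldsymbol\theta)$ is equivalent to minimizing $$\overline J(\boldsymbol\gamma)=\frac12\overline g(\boldsymbol\gamma)^\top\overline{\boldsymbol\Sigma}\,\overline g(\boldsymbol\gamma)-\langle\overline g(\boldsymbol\gamma),\overline{\mathbf c}\rangle+\frac\lambda2\Omega(\boldsymbol\gamma),$$ where $$\Omega(\boldsymbol\gamma)=\gamma_0^2+\sum_{w\in V\setminus G}\|\boldsymbol\gamma_w\|_2^2+\sum_{i=1}^k\big\langle\mathbf B_i^{-1}(\boldsymbol\gamma_{f_i}-\boldsymbol\beta_{f_i}),\boldsymbol\gamma_{f_i}-\boldsymbol\beta_{f_i}\big\rangle+\sum_{\substack{\ell\in[r]\\ w\in V\setminus F}}\|\boldsymbol\gamma_w^{(\ell)}\|_2^2+\sum_{\substack{i\in[k]\\ \ell\in[r]}}\Big\|\boldsymbol\gamma_{f_i}^{(\ell)}-\sum_{c\in S_i}\mathbf R_c^\top\boldsymbol\gamma_c^{(\ell)}\Big\|_2^2 ,$$ with $\boldsymbol\beta_{f_i}$ regarded as a function of $\boldsymbol\gamma$ via $\boldsymbol\theta_c^{(\ell)}=\boldsymbol\gamma_c^{(\ell)}$ for $c\in S_i$ and $\boldsymbol\theta_{f_i}^{(\ell)}=\boldsymbol\gamma_{f_i}^{(\ell)}-\sum_{c\in S_i}\mathbf 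R_c^\top\boldsymbol\gamma_c^{(\ell)}$.
   Context: Data: $V$ is a finite set of features, each categorical or continuous. $D$ is a nonempty finite multiset of pairs $(\mathbf x,y)$, $y\in\mathbb R$, $\mathbf x=(\mathbf x_v)_{v\in V}$; if $v$ is categorical with $N_v$ categories, $\mathbf x_v\in\{0,1\}^{N_v}$ is a standard unit vector (one-hot encoding); if $v$ is continuous, $\mathbf x_v\in\mathbb R$ and $N_v=1$. $\lambda\ge0$. $\|\boldsymbol\theta\|_2^2$ is the sum of squares of all scalar parameters. $\otimes$ is the Kronecker product, $\circ$ the entrywise (Hadamard) product, $\binom A2$ the set of 2-element subsets of $A$. Groups of simple FDs: $G_1,\dots,G_k\subseteq V$ are disjoint, $G_i=\{f_i\}\cup S_i$ (with $f_i\notin S_i$), each $f_i$ is categorical, and for every $c\in S_i$ there is an $N_c\times N_{f_i}$ matrix $\mathbf R_c$ with $\mathbf x_c=\mathbf R_c\mathbf x_{f_i}$ for all $(\mathbf x,y)\in D$; $\mathbf R_{f_i}=\mathbf I_{f_i}$ is the $N_{f_i}\times N_{f_i}$ identity. $\mathbf B_i=\sum_{c\in G_i}\mathbf R_c^\top\mathbf R_c$. Let $S=\bigcup_iS_i$ and $\overline S=V\setminus S$. Reduced functions: $\overline h(\mathbf x)$ is the vector with blocks $\overline h_\emptyset=1$, $\overline h_{\{i\}}=\mathbf x_i$ and $\overline h_{\{i,j\}}=\mathbf x_i\otimes\mathbf x_j$ for $i\neq j\in\overline S$ (all components involving a feature of $S$ removed), and $\overline g(\boldsymbol\gamma)$ is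 the corresponding vector with blocks $\overline g_\emptyset=\gamma_0$, $\overline g_{\{i\}}=\boldsymbol\gamma_i$, $\overline g_{\{i,j\}}=\sum_{\ell=1}^r\boldsymbol\gamma_i^{(\ell)}\otimes\boldsymbol\gamma_j^{(\ell)}$. $\overline{\boldsymbol\Sigma}=\frac1{|D|}\sum_{(\mathbf x,y)\in D}\overline h(\mathbf x)\overline h(\mathbf x)^\top$, $\overline{\mathbf c}=\frac1{|D|}\sum_{(\mathbf x,y)\in D}y\,\overline h(\mathbf x)$. The parameter $\boldsymbol\gamma$ consists of $\gamma_0$, $\boldsymbol\gamma_w$ for $w\in\overline S$, and $\boldsymbol\gamma_w^{(\ell)}$ for $w\in V$, $\ell\in[r]$. ''Minimizing $J(\boldsymbol\theta)$ is equivalent to minimizing $\overline J(\boldsymbol\gamma)$'' means: up to the additive constant $\frac1{2|D|}\sum_{(\mathbf x,y)\in D}y^2$ the two infima coincide; the reparameterization maps every minimizer of $J$ to a minimizer of $\overline J$; and every minimizer of $\overline J$ is the image of some minimizer of $J$. *)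

(* Defs.v *)
From HB Require Import structures.
From mathcomp Require Import all_boot all_order all_algebra.
From mathcomp Require Import all_classical all_reals all_analysis.

Set Implicit Arguments.
Unset Strict Implicit.
Unset Printing Implicit Defensive.
Import Order.TTheory GRing.Theory Num.Theory.
Local Open Scope ring_scope.

(* The infima are taken in the extended reals: no boundedness is presupposed. *)

Definition is_minimizer {R : realType} {T : Type} (J : T -> R) (t : T) : Prop :=
  forall u, J t <= J u.

Definition equivalent_minimization {R : realType} {T U : Type}
    (J : T -> R) (K : U -> R) (phi : T -> U) (a : R) : Prop :=
  [/\ ereal_inf (range (fun t => (J t)%:E))
        = (ereal_inf (range (fun u => (K u)%:E)) + a%:E)%E,
      forall t, is_minimizer J t -> is_minimizer K (phi t)
    & forall u, is_minimizer K u -> exists2 t, is_minimizer J t & phi t = u].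

Definition dot {R : realType} {n : nat} (u v : 'cV[R]_n) : R := (u^T *m v) 0 0.

Definition sqnorm {R : realType} {n : nat} (u : 'cV[R]_n) : R := dot u u.

(* [mxvec] is row-major, so the entries u_i v_j come in lexicographic order. *)
Definition kron {R : realType} {m n : nat} (u : 'cV[R]_m) (v : 'cV[R]_n) :
    'cV[R]_(m * n) := (mxvec (u *m v^T))^T.

Definition hadamard {R : realType} {n : nat} (u v : 'cV[R]_n) : 'cV[R]_n :=
  map2_mx *%R u v.

(* The 2-element subsets {i, j} of A, each represented by its unique
   orientation (i, j) in which i precedes j in the enumeration of V. *)
Definition pairs {V : finType} (A : {set V}) : {set V * V} :=
  [set p | [&& p.1 \in A, p.2 \in A & (enum_rank p.1 < enum_rank p.2)%N]].

(* [lead i] is f_i and [deps i] is S_i. *)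
Record fd_groups (V : finType) (k : nat) := FDGroups {
  lead : 'I_k -> V;
  deps : 'I_k -> {set V};
  lead_notin : forall i, lead i \notin deps i;
  groups_disjoint : forall i j, i != j ->
    [disjoint lead i |: deps i & lead j |: deps j]
}.

Section Groups.
Context {V : finType} {k : nat} (G : fd_groups V k).

Definition group (i : 'I_k) : {set V} := lead G i |: deps G i.
Definition groupU : {set V} := \bigcup_i group i.
Definition leads : {set V} := [set lead G i | i : 'I_k].
Definition depsU : {set V} := \bigcup_i deps G i.

Definition kept : finType := {v : V | v \in ~: depsU}.

Lemma lead_kept (i : 'I_k) : lead G i \in ~: depsU.
Proof.
rewrite inE; apply/bigcupP => -[j _ fij].
have [eij | neij] := eqVneq i j.
  by move: fij; rewrite -eij (negPf (lead_notin G i)).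
have /disjointFr/(_ (setU11 _ _)) := groups_disjoint G neij.
by rewrite !inE fij orbT.
Qed.

Definition keptlead (i : 'I_k) : kept := exist _ (lead G i) (lead_kept i).

(* [Some i] exactly when w = f_i; such an i is unique since groups are
   disjoint. *)
Definition lead_index (w : V) : option 'I_k := [pick i | lead G i == w].

End Groups.

(* An input vector x; finite functions provide the decidable equality used for
   membership in the data set. *)
Definition input (R : realType) (V : finType) (N : V -> nat) :=
  {dffun forall v : V, 'cV[R]_(N v)}.

(* theta_0, theta_v and theta_v^(l), the last one being [theta2 l v]. *)
Record fm_params (R : realType) (V : finType) (N : V -> nat) (r : nat) :=
  FMParams {
    theta0 : R;
    theta1 : forall v : V, 'cV[R]_(N v);
    theta2 : 'I_r -> forall v : V, 'cV[R]_(N v)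
  }.

Record reduced_params (R : realType) (V : finType) (N : V -> nat) (r k : nat)
    (G : fd_groups V k) := ReducedParams {
  gamma0 : R;
  gamma1 : forall w : kept G, 'cV[R]_(N (val w));
  gamma2 : 'I_r -> forall w : V, 'cV[R]_(N w)
}.

Section FactorizationMachine.
Context {R : realType} {V : finType} {N : V -> nat} {r : nat}.
Variables (lambda : R) (D : seq (input R N * R)).

Definition fm_predict (t : fm_params R N r) (x : input R N) : R :=
  theta0 t + \sum_(v : V) dot (theta1 t v) (x v)
  + \sum_(p in pairs [set: V])
      dot (\sum_(l < r) kron (theta2 t l p.1) (theta2 t l p.2))
          (kron (x p.1) (x p.2)).

Definition sqnorm_params (t : fm_params R N r) : R :=
  theta0 t ^+ 2 + \sum_(v : V) sqnorm (theta1 t v)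
  + \sum_(l < r) \sum_(v : V) sqnorm (theta2 t l v).

Definition J (t : fm_params R N r) : R :=
  (2 * (size D)%:R)^-1 * (\sum_(d <- D) (fm_predict t d.1 - d.2) ^+ 2)
  + lambda / 2 * sqnorm_params t.

Definition label_energy : R :=
  (2 * (size D)%:R)^-1 * \sum_(d <- D) d.2 ^+ 2.

Context {k : nat}.
Variables (G : fd_groups V k) (Rm : forall c w : V, 'M[R]_(N c, N w)).

(* For c in G_i the matrix R_c is [Rm c (lead G i)]; other values of [Rm] are
   irrelevant. Below, [beta i w] is beta_{f_i} when w = f_i: having w as a
   separate argument avoids transporting along an equality w = f_i. *)

Definition B (i : 'I_k) : 'M[R]_(N (lead G i)) :=
  \sum_(c in group G i) (Rm c (lead G i))^T *m Rm c (lead G i).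

Definition beta (i : 'I_k) (w : V)
    (t2 : 'I_r -> forall v : V, 'cV[R]_(N v)) : 'cV[R]_(N w) :=
  \sum_(l < r) \sum_(p in pairs (group G i))
    hadamard ((Rm p.1 w)^T *m t2 l p.1) ((Rm p.2 w)^T *m t2 l p.2).

Definition reparam (t : fm_params R N r) : reduced_params R N r G :=
  ReducedParams
    (theta0 t)
    (fun w : kept G =>
       if lead_index G (val w) is Some i then
         theta1 t (val w)
         + \sum_(c in deps G i) (Rm c (val w))^T *m theta1 t c
         + beta i (val w) (theta2 t)
       else theta1 t (val w))
    (fun l w =>
       if lead_index G w is Some i then
         theta2 t l w + \sum_(c in deps G i) (Rm c w)^T *m theta2 t l c
       else theta2 t l w).

(* The theta_w^(l) expressed in terms of the gamma_w^(l). *)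
Definition theta2_of (g : reduced_params R N r G) (l : 'I_r) (w : V) :
    'cV[R]_(N w) :=
  if lead_index G w is Some i then
    gamma2 g l w - \sum_(c in deps G i) (Rm c w)^T *m gamma2 g l c
  else gamma2 g l w.

Definition hbar (x : input R N) :=
  col_mx (const_mx 1 : 'cV[R]_1)
    (col_mx
      (\mxcol_(a < #|{: kept G}|) x (val (enum_val a)))
      (\mxcol_(a < #|pairs (~: depsU G)|)
         kron (x (enum_val a).1) (x (enum_val a).2))).

Definition gbar (g : reduced_params R N r G) :=
  col_mx (const_mx (gamma0 g) : 'cV[R]_1)
    (col_mx
      (\mxcol_(a < #|{: kept G}|) gamma1 g (enum_val a))
      (\mxcol_(a < #|pairs (~: depsU G)|)
         \sum_(l < r) kron (gamma2 g l (enum_val a).1)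
                           (gamma2 g l (enum_val a).2))).

Definition Sigmabar :=
  (size D)%:R^-1 *: \sum_(d <- D) (hbar d.1 *m (hbar d.1)^T).

Definition cbar := (size D)%:R^-1 *: \sum_(d <- D) d.2 *: hbar d.1.

Definition Omega (g : reduced_params R N r G) : R :=
  gamma0 g ^+ 2
  + \sum_(w : kept G | val w \notin groupU G) sqnorm (gamma1 g w)
  + \sum_(i < k)
      (let u := gamma1 g (keptlead G i) - beta i (lead G i) (theta2_of g) in
       dot (invmx (B i) *m u) u)
  + \sum_(l < r) \sum_(w in ~: leads G) sqnorm (gamma2 g l w)
  + \sum_(i < k) \sum_(l < r)
      sqnorm (gamma2 g l (lead G i)
              - \sum_(c in deps G i)
                  (Rm c (lead G i))^T *m gamma2 g l c).

Definition Jbar (g : reduced_params R N r G) : R :=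
  2^-1 * dot (gbar g) (Sigmabar *m gbar g) - dot (gbar g) cbar
  + lambda / 2 * Omega g.

End FactorizationMachine.

(* Main.v *)
(** On the data, x_c = R_c x_f turns every inner product <theta_c, x_c> within a
group into <R_c^T theta_c, x_f>, and since x_f is one-hot a product of two such
inner products is again linear in x_f. Combined with
  sum_{i<j} a_i a_j = ((sum a)^2 - sum a^2) / 2,
this shows that the prediction depends on theta only through its
reparameterization gamma. On a fibre of the reparameterization the pairwise
parameters are determined by gamma, while the theta_c of a group are constrained
only by sum_c R_c^T theta_c = gamma_f - beta_f; the least norm under this
constraint is the B^-1 quadratic form, attained at
theta_c = R_c B^-1 (gamma_f - beta_f). Thus Jbar is, up to the constant, the
minimum of J over each fibre, and this minimum is attained. *)

Require Import Defs.
From HB Require Import structures.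
From mathcomp Require Import all_boot all_order all_algebra.
From mathcomp Require Import all_classical all_reals all_analysis.
From mathcomp Require Import ring.

Set Implicit Arguments.
Unset Strict Implicit.
Unset Printing Implicit Defensive.
Import Order.TTheory GRing.Theory Num.Theory.
Local Open Scope ring_scope.

(** * Minimization in two stages along the fibres of a map *)

(** The hypotheses say that [K + a] is the attained minimum of [J] over each fibre of [phi], and
    that every fibre is nonempty. All three clauses follow by minimizing first within a fibre, then
    over fibres. *)
Lemma equivalent_minimization_fiberwise (R : realType) (T U : Type)
    (J : T -> R) (K : U -> R) (phi : T -> U) (a : R) :
  (forall t, K (phi t) + a <= J t) ->
  (forall u, exists2 t, phi t = u & J t = K u + a) ->
  equivalent_minimization J K phi a.
Proof.
move=> KJ lift; split.
- apply/eqP; rewrite eq_le; apply/andP; split.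
  + rewrite -leeBlDr //; apply/ereal_infP => _ [u _ <-].
    have [t _ Jt] := lift u.
    rewrite leeBlDr // -EFinD -Jt; apply: ge_ereal_inf.
    by exists (J t)%:E => //; exists t.
  + apply/ereal_infP => _ [t _ <-].
    apply: (@le_trans _ _ ((K (phi t))%:E + a%:E)%E); last first.
      by rewrite -EFinD lee_fin.
    rewrite leeD2r //; apply: ge_ereal_inf.
    by exists (K (phi t))%:E => //; exists (phi t).
- move=> t minJ u; have [t' _ Jt'] := lift u.
  by rewrite -(lerD2r a) -Jt'; apply: le_trans (minJ t').
- move=> u minK; have [t phit Jt] := lift u.
  exists t => // t'; rewrite Jt; apply: le_trans (KJ t').
  by rewrite lerD2r.
Qed.

(** * Inner products against Kronecker, Hadamard and block vectors *)

Section Dot.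
Context {R : realType}.

Lemma dotE n (u v : 'cV[R]_n) : dot u v = \sum_j u j 0 * v j 0.
Proof. by rewrite /dot mxE; apply: eq_bigr => j _; rewrite mxE. Qed.

Lemma dotC n (u v : 'cV[R]_n) : dot u v = dot v u.
Proof. by rewrite !dotE; apply: eq_bigr => j _; rewrite mulrC. Qed.

Lemma dotDl n (u v w : 'cV[R]_n) : dot (u + v) w = dot u w + dot v w.
Proof. by rewrite /dot linearD mulmxDl mxE. Qed.

Lemma dotBl n (u v w : 'cV[R]_n) : dot (u - v) w = dot u w - dot v w.
Proof. by rewrite /dot linearB mulmxBl !mxE. Qed.

Lemma dotBr n (u v w : 'cV[R]_n) : dot w (u - v) = dot w u - dot w v.
Proof. by rewrite dotC dotBl !(dotC w). Qed.

Lemma dotZr n (a : R) (u v : 'cV[R]_n) : dot u (a *: v) = a * dot u v.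
Proof. by rewrite /dot -scalemxAr mxE. Qed.

Lemma dot_suml n I (s : seq I) (P : pred I) (F : I -> 'cV[R]_n) v :
  dot (\sum_(i <- s | P i) F i) v = \sum_(i <- s | P i) dot (F i) v.
Proof. by rewrite /dot linear_sum mulmx_suml summxE. Qed.

Lemma dot_sumr n I (s : seq I) (P : pred I) (F : I -> 'cV[R]_n) v :
  dot v (\sum_(i <- s | P i) F i) = \sum_(i <- s | P i) dot v (F i).
Proof. by rewrite dotC dot_suml; apply: eq_bigr => i _; rewrite dotC. Qed.

Lemma dot_trmxl m n (A : 'M[R]_(m, n)) (u : 'cV[R]_m) (v : 'cV[R]_n) :
  dot (A^T *m u) v = dot u (A *m v).
Proof. by rewrite /dot trmx_mul trmxK mulmxA. Qed.

Lemma sqnorm_ge0 n (u : 'cV[R]_n) : 0 <= sqnorm u.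
Proof. by rewrite /sqnorm dotE sumr_ge0 // => j _; rewrite -expr2 sqr_ge0. Qed.

Lemma sqnorm_eq0 n (u : 'cV[R]_n) : (sqnorm u == 0) = (u == 0).
Proof.
apply/eqP/eqP => [|->]; last by rewrite /sqnorm /dot mulmx0 mxE.
rewrite /sqnorm dotE => /psumr_eq0P u0; apply/colP => j; rewrite mxE.
have /eqP := u0 (fun i _ => sqr_ge0 (u i 0)) j isT.
by rewrite mulf_eq0 orbb => /eqP.
Qed.

(** By [mxvec_dotmul] the left side is the bilinear form u^T (x y^T) v, which factors as (u^T x)(y^T
    v). *)
Lemma dot_kron m n (u x : 'cV[R]_m) (v y : 'cV[R]_n) :
  dot (kron u v) (kron x y) = dot u x * dot v y.
Proof.
rewrite /kron /dot trmxK -{1}(trmxK u) mxvec_dotmul trmxK mulmxA -mulmxA.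
by rewrite mxE big_ord1; congr (_ * _); rewrite -[RHS]dotC.
Qed.

(** Pairing with a unit vector reads off one entry, and entries of a Hadamard product multiply. This
    is how one-hot encoding makes a product of two linear forms linear again. *)
Lemma dot_hadamard_delta n (u v : 'cV[R]_n) (j : 'I_n) :
  dot (hadamard u v) (delta_mx j 0)
  = dot u (delta_mx j 0) * dot v (delta_mx j 0).
Proof.
have dot_delta (w : 'cV[R]_n) : dot w (delta_mx j 0) = w j 0.
  rewrite dotE (bigD1 j) //= mxE !eqxx mulr1 big1 ?addr0 // => i ij.
  by rewrite mxE (negPf ij) mulr0.
by rewrite !dot_delta mxE.
Qed.

Lemma dot_col_mx m n (u x : 'cV[R]_m) (v y : 'cV[R]_n) :
  dot (col_mx u v) (col_mx x y) = dot u x + dot v y.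
Proof. by rewrite /dot tr_col_mx mul_row_col mxE. Qed.

Lemma dot_mxcol p (p_ : 'I_p -> nat) (u v : forall i, 'cV[R]_(p_ i)) :
  dot (\mxcol_i u i) (\mxcol_i v i) = \sum_i dot (u i) (v i).
Proof. by rewrite /dot tr_mxcol mul_mxrow_mxcol summxE. Qed.

End Dot.

(** * Sums over unordered pairs *)

Lemma big_pairs (R : realType) (V : finType) (A : {set V}) (a : V -> R) :
  \sum_(p in pairs A) a p.1 * a p.2
  = 2^-1 * ((\sum_(v in A) a v) ^+ 2 - \sum_(v in A) a v ^+ 2).
Proof.
set S := \sum_(p in _) _.
have split_sqr : (\sum_(v in A) a v) ^+ 2
    = \sum_(v in A) a v ^+ 2 + S + S.
  rewrite expr2 big_distrlr /=.
  (* The double sum splits into the diagonal, which gives the squares, and the pairs of distinct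
     features, which the enumeration order then cuts into two halves. *)
  rewrite pair_big /= (bigID (fun p => p.1 == p.2)) /= -addrA; congr (_ + _).
    rewrite (reindex_onto (fun v => (v, v)) fst) /=; last first.
      by move=> [u v] /= /andP[_ /eqP ->].
    by apply: eq_bigl => v; rewrite !eqxx !andbT andbb.
  rewrite (bigID (fun p => (enum_rank p.1 < enum_rank p.2)%N)) /=.
  congr (_ + _).
    apply: eq_bigl => -[u v] /=; rewrite inE /= -!andbA.
    do 2!congr (_ && _); case: eqVneq => [->|//]; by rewrite ltnn.
  (* Swapping coordinates carries the decreasing pairs onto [pairs A], so the second half equals the
     first. *)
  rewrite (reindex_onto (fun p => (p.2, p.1)) (fun p => (p.2, p.1))) /=;
    last by case.
  rewrite /S; under [RHS]eq_bigr => p _ do rewrite mulrC.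
  apply: eq_bigl => -[u v] /=; rewrite inE /= -leqNgt leq_eqVlt eqxx andbT.
  rewrite (inj_eq val_inj) (inj_eq enum_rank_inj) (eq_sym v).
  rewrite andbCA -!andbA; do 2!congr (_ && _).
  by case: eqVneq => [->|_]; rewrite ?ltnn.
by rewrite split_sqr; field.
Qed.

(** * Disjoint groups and sums split along them *)

Section GroupSums.
Context {V : finType} {k : nat} (G : fd_groups V k).

Lemma lead_in_group i : lead G i \in group G i.
Proof. exact: setU11. Qed.

Lemma deps_sub_group i c : c \in deps G i -> c \in group G i.
Proof. by move=> ci; rewrite setU1r. Qed.

Lemma group_inj i j v : v \in group G i -> v \in group G j -> i = j.
Proof.
move=> vi vj; apply/eqP/negPn/negP => /(groups_disjoint G) /disjointFr.
by move=> /(_ _ vi); rewrite vj.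
Qed.

Lemma lead_inj : injective (lead G).
Proof.
move=> i j ij; apply: (@group_inj _ _ (lead G i)); first exact: lead_in_group.
by rewrite ij lead_in_group.
Qed.

Lemma lead_index_lead i : lead_index G (lead G i) = Some i.
Proof.
rewrite /lead_index; case: pickP => [j /eqP /lead_inj -> //|].
by move=> /(_ i); rewrite eqxx.
Qed.

Lemma lead_index_notin w : w \notin leads G -> lead_index G w = None.
Proof.
move=> wG; rewrite /lead_index; case: pickP => [j /eqP jw|//].
by rewrite -jw imset_f in wG.
Qed.

Lemma deps_notin_leads i c : c \in deps G i -> c \notin leads G.
Proof.
move=> ci; apply/imsetP => -[j _ cj].
have ij : i = j.
  by apply: (@group_inj _ _ c); rewrite ?cj ?lead_in_group // -cj deps_sub_group.
by move: ci; rewrite cj -ij (negPf (lead_notin G i)).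
Qed.

Lemma groupU_notin_leads w : w \notin groupU G -> w \notin leads G.
Proof.
apply: contra => /imsetP[i _ ->]; apply/bigcupP; exists i => //.
exact: lead_in_group.
Qed.

(** Removing [depsU G] leaves only the lead of each group. *)
Lemma kept_in_groupU (w : kept G) :
  (val w \in groupU G) = (val w \in leads G).
Proof.
apply/idP/idP => [/bigcupP[i _]|]; last first.
  by apply: contraLR => /groupU_notin_leads.
rewrite inE => /orP[|wi]; first by rewrite inE => /eqP ->; rewrite imset_f.
have := valP w; rewrite inE => /bigcupP[]; by exists i.
Qed.

Section Sums.
Context {M : nmodType}.

Lemma big_group i (F : V -> M) :
  \sum_(c in group G i) F c = F (lead G i) + \sum_(c in deps G i) F c.
Proof. by rewrite big_setU1 ?lead_notin. Qed.

Lemma big_groups (F : V -> M) :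
  \sum_v F v
  = \sum_(v | v \notin groupU G) F v + \sum_i \sum_(c in group G i) F c.
Proof.
rewrite (bigID (mem (groupU G))) /= addrC partition_disjoint_bigcup //.
exact: groups_disjoint.
Qed.

Lemma big_leads (F : V -> M) :
  \sum_v F v = \sum_(v in ~: leads G) F v + \sum_i F (lead G i).
Proof.
rewrite (bigID (mem (leads G))) /= addrC; congr (_ + _).
  by apply: eq_bigl => v; rewrite inE.
by rewrite big_imset //= => i j _ _; apply: lead_inj.
Qed.

Lemma big_kept (F : kept G -> M) :
  \sum_w F w = \sum_(w : kept G | val w \notin groupU G) F w
               + \sum_i F (keptlead G i).
Proof.
rewrite (bigID (fun w : kept G => val w \in groupU G)) /= addrC.
congr (_ + _).
rewrite -(big_imset (h := keptlead G) (A := xpredT)) /=; last first.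
  by move=> i j _ _ /(congr1 val) /lead_inj.
apply: eq_bigl => w; rewrite kept_in_groupU; apply/imsetP/imsetP.
  by move=> [i _ wi]; exists i => //; apply: val_inj.
by move=> [i _ ->]; exists i.
Qed.

Lemma big_not_groupU (F : V -> M) :
  \sum_(v | v \notin groupU G) F v
  = \sum_(w : kept G | val w \notin groupU G) F (val w).
Proof.
rewrite -(big_sub_cond (mem (~: depsU G)) [pred v | v \notin groupU G]) /=.
apply: eq_bigl => v; rewrite andb_idl // inE; apply: contra.
move=> /bigcupP[i _ vi]; apply/bigcupP; exists i => //.
exact: deps_sub_group.
Qed.

Lemma big_not_depsU (F : V -> M) :
  \sum_(v in ~: depsU G) F v
  = \sum_(v | v \notin groupU G) F v + \sum_i F (lead G i).
Proof. by rewrite big_sub big_kept big_not_groupU. Qed.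

End Sums.
End GroupSums.

(** * Predictions and objectives through sums of inner products *)

Section Reparametrization.
Context {R : realType} {V : finType} {N : V -> nat} {r k : nat}.
Variables (lambda : R) (D : seq (input R N * R)) (G : fd_groups V k)
  (Rm : forall c w : V, 'M[R]_(N c, N w)).

(** In this form the pairwise term involves only a sum over features and a sum of squares, both of
    which split along the groups. *)
Lemma fm_predictE (t : fm_params R N r) (x : input R N) :
  fm_predict t x
  = theta0 t + \sum_v dot (theta1 t v) (x v)
    + \sum_(l < r) 2^-1 * ((\sum_v dot (theta2 t l v) (x v)) ^+ 2
                           - \sum_v dot (theta2 t l v) (x v) ^+ 2).
Proof.
rewrite /fm_predict; congr (_ + _).
under eq_bigr => p _ do rewrite dot_suml.
rewrite exchange_big; apply: eq_bigr => l _.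
under eq_bigr => p _ do rewrite dot_kron.
rewrite (big_pairs _ (fun v => dot (theta2 t l v) (x v))).
by congr (_ * (_ ^+ 2 - _)); apply: eq_bigl => v; rewrite inE.
Qed.

Lemma dot_gbar_hbar (g : reduced_params R N r G) (x : input R N) :
  dot (gbar g) (hbar G x)
  = gamma0 g + \sum_(w : kept G) dot (gamma1 g w) (x (val w))
    + \sum_(l < r) 2^-1 *
        ((\sum_(v in ~: depsU G) dot (gamma2 g l v) (x v)) ^+ 2
         - \sum_(v in ~: depsU G) dot (gamma2 g l v) (x v) ^+ 2).
Proof.
rewrite /gbar /hbar !dot_col_mx !dot_mxcol addrA; congr (_ + _ + _).
- by rewrite dotE big_ord1 !mxE mulr1.
- by rewrite -(big_enum_val (fun w : kept G => dot (gamma1 g w) (x (val w)))).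
rewrite -(big_enum_val (fun p : V * V =>
  dot (\sum_(l < r) kron (gamma2 g l p.1) (gamma2 g l p.2))
      (kron (x p.1) (x p.2)))) /=.
under eq_bigr => p _ do rewrite dot_suml.
rewrite exchange_big; apply: eq_bigr => l _.
under eq_bigr => p _ do rewrite dot_kron.
exact: (big_pairs _ (fun v => dot (gamma2 g l v) (x v))).
Qed.

(** For [w] a lead and [x] its value, [Rm c w *m x] is the value of [c], so [beta] carries the
    interactions within a group into the linear coefficient of its lead. *)
Lemma dot_beta (i : 'I_k) (w : V) (t2 : 'I_r -> forall v, 'cV[R]_(N v))
    (x : 'cV[R]_(N w)) (x_onehot : exists j, x = delta_mx j 0) :
  dot (beta G Rm i w t2) x
  = \sum_(l < r) 2^-1 *
      ((\sum_(c in group G i) dot (t2 l c) (Rm c w *m x)) ^+ 2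
       - \sum_(c in group G i) dot (t2 l c) (Rm c w *m x) ^+ 2).
Proof.
rewrite dot_suml; apply: eq_bigr => l _.
rewrite -(big_pairs _ (fun c => dot (t2 l c) (Rm c w *m x))) dot_suml.
apply: eq_bigr => p _; have [j ->] := x_onehot.
by rewrite dot_hadamard_delta !dot_trmxl.
Qed.

(** Expanding the squares on the right yields the [Sigmabar] quadratic form, the [cbar] linear term
    and the constant [label_energy D]. *)
Lemma JbarE (g : reduced_params R N r G) :
  Jbar lambda D Rm g + label_energy D
  = (2 * (size D)%:R)^-1
      * (\sum_(d <- D) (dot (gbar g) (hbar G d.1) - d.2) ^+ 2)
    + lambda / 2 * Omega Rm g.
Proof.
rewrite /Jbar addrAC; congr (_ + _).
rewrite /Sigmabar /cbar /label_energy -scalemxAl !dotZr mulmx_suml !dot_sumr.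
rewrite invfM !mulr_sumr -sumrB -big_split /=.
apply: eq_bigr => d _; rewrite dotZr -mulmxA -dot_trmxl.
have -> : (hbar G d.1)^T *m gbar g = (dot (gbar g) (hbar G d.1))%:M.
  by rewrite [LHS]mx11_scalar -[X in X%:M]/(dot _ _) dotC.
(* With the inverse size abstracted as [s], the identity is polynomial in [s], and 2 is the only
   denominator left to [field]. *)
by rewrite dotE big_ord1 !mxE mulr1n; set s := (size D)%:R^-1; field.
Qed.

(** * The reparameterization and invariance of the prediction *)

Hypothesis Rm_lead : forall i, Rm (lead G i) (lead G i) = 1%:M.

Lemma reparam_gamma1_lead (t : fm_params R N r) i :
  gamma1 (reparam G Rm t) (keptlead G i)
  = \sum_(c in group G i) (Rm c (lead G i))^T *m theta1 t c
    + beta G Rm i (lead G i) (theta2 t).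
Proof.
by rewrite /reparam /= lead_index_lead big_group Rm_lead trmx1 mul1mx.
Qed.

Lemma reparam_gamma1_notin (t : fm_params R N r) (w : kept G) :
  val w \notin leads G -> gamma1 (reparam G Rm t) w = theta1 t (val w).
Proof. by move=> /lead_index_notin wG; rewrite /reparam /= wG. Qed.

Lemma reparam_gamma2_lead (t : fm_params R N r) l i :
  gamma2 (reparam G Rm t) l (lead G i)
  = \sum_(c in group G i) (Rm c (lead G i))^T *m theta2 t l c.
Proof.
by rewrite /reparam /= lead_index_lead big_group Rm_lead trmx1 mul1mx.
Qed.

Lemma reparam_gamma2_notin (t : fm_params R N r) l w :
  w \notin leads G -> gamma2 (reparam G Rm t) l w = theta2 t l w.
Proof. by move=> /lead_index_notin wG; rewrite /reparam /= wG. Qed.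

Lemma theta2_of_lead (g : reduced_params R N r G) l i :
  theta2_of Rm g l (lead G i)
  = gamma2 g l (lead G i)
    - \sum_(c in deps G i) (Rm c (lead G i))^T *m gamma2 g l c.
Proof. by rewrite /theta2_of lead_index_lead. Qed.

Lemma theta2_of_notin (g : reduced_params R N r G) l w :
  w \notin leads G -> theta2_of Rm g l w = gamma2 g l w.
Proof. by move=> /lead_index_notin wG; rewrite /theta2_of wG. Qed.

Lemma eq_theta2 (t2 t2' : 'I_r -> forall v, 'cV[R]_(N v)) :
  (forall l i, t2 l (lead G i) = t2' l (lead G i)) ->
  (forall l w, w \notin leads G -> t2 l w = t2' l w) -> t2 = t2'.
Proof.
move=> tlead tnotin; apply/funext => l; apply: functional_extensionality_dep.
move=> w; have [/imsetP[i _ ->] //|] := boolP (w \in leads G).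
exact: tnotin.
Qed.

(** Dependent features are not leads, so [reparam] keeps their pairwise parameters, and the sum it
    adds at a lead is the one [theta2_of] subtracts. Hence pairwise parameters are constant on
    fibres. *)
Lemma theta2_of_reparam (t : fm_params R N r) :
  theta2_of Rm (reparam G Rm t) = theta2 t.
Proof.
apply: eq_theta2 => [l i|l w wG]; last first.
  by rewrite theta2_of_notin ?reparam_gamma2_notin.
rewrite theta2_of_lead reparam_gamma2_lead big_group Rm_lead trmx1 mul1mx.
rewrite -addrA -sumrB big1 ?addr0 // => c ci.
by rewrite reparam_gamma2_notin ?subrr ?(deps_notin_leads ci).
Qed.

(** Let s_i and q_i be the sum and the sum of squares of the inner products in group i. The reduced
    pairwise term subtracts s_i^2 where the full one subtracts q_i; the [beta] part of the linear
    term adds the missing (s_i^2 - q_i) / 2. *)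
Lemma fm_predict_reparam (t : fm_params R N r) (x : input R N)
    (x_onehot : forall i, exists j, x (lead G i) = delta_mx j 0)
    (x_fd : forall i c, c \in deps G i ->
       x c = Rm c (lead G i) *m x (lead G i)) :
  fm_predict t x = dot (gbar (reparam G Rm t)) (hbar G x).
Proof.
have group_fd i c : c \in group G i -> Rm c (lead G i) *m x (lead G i) = x c.
  rewrite !inE => /orP[/eqP ->|/x_fd //]; by rewrite Rm_lead mul1mx.
pose a l v := dot (theta2 t l v) (x v).
have dot_lead (u : forall v, 'cV[R]_(N v)) i :
    dot (\sum_(c in group G i) (Rm c (lead G i))^T *m u c) (x (lead G i))
    = \sum_(c in group G i) dot (u c) (x c).
  rewrite dot_suml; apply: eq_bigr => c /group_fd xc.
  by rewrite dot_trmxl xc.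
have linear_part : \sum_(w : kept G) dot (gamma1 (reparam G Rm t) w) (x (val w))
    = \sum_v dot (theta1 t v) (x v)
      + \sum_(l < r) \sum_i 2^-1 * ((\sum_(c in group G i) a l c) ^+ 2
                                    - \sum_(c in group G i) a l c ^+ 2).
  rewrite exchange_big big_kept (big_groups G) -addrA -big_split.
  congr (_ + _).
    rewrite (big_not_groupU G (fun v => dot (theta1 t v) (x v))).
    apply: eq_bigr => w wG.
    by rewrite reparam_gamma1_notin ?groupU_notin_leads.
  apply: eq_bigr => i _; rewrite reparam_gamma1_lead dotDl dot_lead.
  rewrite dot_beta; last exact: x_onehot.
  congr (_ + _); apply: eq_bigr => l _.
  by congr (_ * (_ ^+ 2 - _)); apply: eq_bigr => c /group_fd ->.
(* An arbitrary [f] covers both the plain sum and the sum of squares. *)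
have gamma2_part l (f : R -> R) :
    \sum_(v in ~: depsU G) f (dot (gamma2 (reparam G Rm t) l v) (x v))
    = \sum_(v | v \notin groupU G) f (a l v)
      + \sum_i f (\sum_(c in group G i) a l c).
  rewrite big_not_depsU; congr (_ + _); apply: eq_bigr => v vG.
    by rewrite reparam_gamma2_notin ?groupU_notin_leads.
  by rewrite reparam_gamma2_lead dot_lead.
rewrite fm_predictE dot_gbar_hbar linear_part -!addrA.
congr (_ + (_ + _)); rewrite -big_split; apply: eq_bigr => l _.
rewrite (gamma2_part l id) (gamma2_part l (fun z => z ^+ 2)) !(big_groups G).
rewrite -mulr_sumr sumrB /= /a; ring.
Qed.

(** * The norm on a fibre and the quadratic form of B^-1 *)

(** The terms are arranged as in [OmegaE], so that the two differ only in the linear parameters of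
    the groups. *)
Lemma sqnorm_paramsE (t : fm_params R N r) :
  sqnorm_params t
  = theta0 t ^+ 2
    + \sum_(w : kept G | val w \notin groupU G)
        sqnorm (gamma1 (reparam G Rm t) w)
    + \sum_i \sum_(c in group G i) sqnorm (theta1 t c)
    + \sum_(l < r) \sum_(w in ~: leads G) sqnorm (gamma2 (reparam G Rm t) l w)
    + \sum_i \sum_(l < r) sqnorm (theta2 t l (lead G i)).
Proof.
rewrite /sqnorm_params (big_groups G) -!addrA; congr (_ + (_ + (_ + _))).
  rewrite (big_not_groupU G (fun v => sqnorm (theta1 t v))).
  apply: eq_bigr => w wG.
  by rewrite reparam_gamma1_notin ?groupU_notin_leads.
rewrite [X in _ = _ + X]exchange_big -big_split; apply: eq_bigr => l _.
rewrite (big_leads G); congr (_ + _); apply: eq_bigr => w.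
by rewrite inE => wG; rewrite reparam_gamma2_notin.
Qed.

Lemma B_mulE i (u : 'cV[R]_(N (lead G i))) :
  B G Rm i *m u
  = \sum_(c in group G i) (Rm c (lead G i))^T *m (Rm c (lead G i) *m u).
Proof. by rewrite mulmx_suml; apply: eq_bigr => c _; rewrite mulmxA. Qed.

(** The lead contributes the identity to B, so <B v, v> = |v|^2 + sum |R_c v|^2 over the dependent
    features, and B v = 0 forces v = 0. *)
Lemma B_unit i : B G Rm i \in unitmx.
Proof.
rewrite -unitmx_tr -row_free_unit; apply: inj_row_free => v.
move=> /(congr1 trmx); rewrite trmx_mul trmxK trmx0 => Bv.
apply: trmx_inj; rewrite trmx0; apply/eqP; rewrite -sqnorm_eq0 eq_le.
rewrite sqnorm_ge0 andbT.
have : dot (B G Rm i *m v^T) v^T = 0 by rewrite Bv /dot trmx0 mul0mx mxE.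
rewrite B_mulE dot_suml big_group Rm_lead trmx1 !mul1mx => /eqP.
rewrite addr_eq0 -/(sqnorm v^T) => /eqP ->; rewrite oppr_le0 sumr_ge0 // => c _.
by rewrite dot_trmxl sqnorm_ge0.
Qed.

(* Completing the square around the least-norm solution [R_c B^-1 u] of
   [sum_c R_c^T theta_c = u]. *)
Lemma group_sqnormE i (t : forall c, 'cV[R]_(N c)) :
  let u := \sum_(c in group G i) (Rm c (lead G i))^T *m t c in
  let z := invmx (B G Rm i) *m u in
  \sum_(c in group G i) sqnorm (t c)
  = dot z u + \sum_(c in group G i) sqnorm (t c - Rm c (lead G i) *m z).
Proof.
move=> u z.
have zu : dot z u = \sum_(c in group G i) dot (Rm c (lead G i) *m z) (t c).
  rewrite dotC dot_suml; apply: eq_bigr => c _; by rewrite dot_trmxl dotC.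
have zz : dot z u
    = \sum_(c in group G i) sqnorm (Rm c (lead G i) *m z).
  have -> : u = B G Rm i *m z by rewrite mulmxA mulmxV ?B_unit // mul1mx.
  rewrite B_mulE dot_sumr; apply: eq_bigr => c _.
  by rewrite dotC dot_trmxl.
(* Two copies of [dot z u] cancel the cross terms of the squares, through [zu]; the third cancels
   the norms of the R_c z, through [zz]. *)
rewrite (_ : dot z u = dot z u + dot z u - dot z u); last by ring.
rewrite {1 2}zu zz -big_split -sumrB -big_split; apply: eq_bigr => c _ /=.
by rewrite /sqnorm dotBl !dotBr (dotC (t c) (_ *m _)); ring.
Qed.

Lemma OmegaE (t : fm_params R N r) :
  Omega Rm (reparam G Rm t)
  = theta0 t ^+ 2
    + \sum_(w : kept G | val w \notin groupU G)
        sqnorm (gamma1 (reparam G Rm t) w)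
    + \sum_i
        (let u := \sum_(c in group G i) (Rm c (lead G i))^T *m theta1 t c in
         dot (invmx (B G Rm i) *m u) u)
    + \sum_(l < r) \sum_(w in ~: leads G) sqnorm (gamma2 (reparam G Rm t) l w)
    + \sum_i \sum_(l < r) sqnorm (theta2 t l (lead G i)).
Proof.
rewrite /Omega theta2_of_reparam; congr (_ + _ + _ + _ + _).
  by apply: eq_bigr => i _; rewrite reparam_gamma1_lead addrK.
apply: eq_bigr => i _; apply: eq_bigr => l _.
by rewrite -theta2_of_lead theta2_of_reparam.
Qed.

(** The excess over [Omega] is a sum of squared distances to the least-norm group parameters: it is
    nonnegative and vanishes at [lift]. *)
Lemma sqnorm_params_reparam (t : fm_params R N r) :
  sqnorm_params t
  = Omega Rm (reparam G Rm t)
    + \sum_i \sum_(c in group G i)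
        sqnorm (theta1 t c - Rm c (lead G i) *m (invmx (B G Rm i) *m
          \sum_(e in group G i) (Rm e (lead G i))^T *m theta1 t e)).
Proof.
rewrite sqnorm_paramsE OmegaE.
rewrite (eq_bigr _ (fun i _ => group_sqnormE i (theta1 t))).
rewrite big_split /=; ring.
Qed.

(** * The least-norm section of the reparameterization *)

(** Matching on [boolP] supplies the membership proof needed to form an element of [kept G]. The
    default 0 goes to features of [depsU G], which [lift] handles through their group. *)
Definition gamma1_ext (g : reduced_params R N r G) (v : V) : 'cV[R]_(N v) :=
  if boolP (v \in ~: depsU G) is AltTrue vk then gamma1 g (exist _ v vk) else 0.

Lemma gamma1_ext_val (g : reduced_params R N r G) (w : kept G) :
  gamma1_ext g (val w) = gamma1 g w.
Proof.
case: w => v vk; rewrite /gamma1_ext /=; case: {-}_ / boolP => [vk'|].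
  by rewrite (bool_irrelevance vk' vk).
by rewrite vk.
Qed.

(* The least-norm preimage of [g] under [reparam]. *)
Definition lift (g : reduced_params R N r G) : fm_params R N r :=
  FMParams (gamma0 g)
    (fun v =>
       if [pick i | v \in group G i] is Some i then
         Rm v (lead G i) *m (invmx (B G Rm i) *m
           (gamma1 g (keptlead G i) - beta G Rm i (lead G i) (theta2_of Rm g)))
       else gamma1_ext g v)
    (theta2_of Rm g).

Lemma lift_theta1_group (g : reduced_params R N r G) i c :
  c \in group G i ->
  theta1 (lift g) c
  = Rm c (lead G i) *m (invmx (B G Rm i) *m
      (gamma1 g (keptlead G i) - beta G Rm i (lead G i) (theta2_of Rm g))).
Proof.
move=> ci; rewrite /lift /=; case: pickP => [j cj|/(_ i)]; last by rewrite ci.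
by rewrite (group_inj cj ci).
Qed.

(** Substituting theta_c = R_c B^-1 u turns the sum into B B^-1 u. *)
Lemma lift_sum_group (g : reduced_params R N r G) i :
  \sum_(c in group G i) (Rm c (lead G i))^T *m theta1 (lift g) c
  = gamma1 g (keptlead G i) - beta G Rm i (lead G i) (theta2_of Rm g).
Proof.
under eq_bigr => c ci do rewrite (lift_theta1_group _ ci).
by rewrite -B_mulE mulmxA mulmxV ?B_unit // mul1mx.
Qed.

Lemma reparam_lift (g : reduced_params R N r G) : reparam G Rm (lift g) = g.
Proof.
(* Eta expansion of both sides reduces the equality of records to equality of their fields. *)
have eta (h : reduced_params R N r G) :
  h = ReducedParams (gamma0 h) (gamma1 h) (gamma2 h) by case: h.
rewrite (eta g) [LHS]eta; congr ReducedParams; rewrite -?eta //.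
  apply: functional_extensionality_dep => w.
  have [/imsetP[i _ wi]|wG] := boolP (val w \in leads G).
    have -> : w = keptlead G i by apply: val_inj.
    by rewrite reparam_gamma1_lead lift_sum_group subrK.
  rewrite reparam_gamma1_notin //= -gamma1_ext_val; case: pickP => // i wi.
  by case/negP: wG; rewrite -kept_in_groupU; apply/bigcupP; exists i.
apply: eq_theta2 => [l i|l w wG].
  rewrite reparam_gamma2_lead big_group Rm_lead trmx1 mul1mx /= theta2_of_lead.
  rewrite -addrA -sumrN -big_split big1 ?addr0 // => c ci /=.
  by rewrite theta2_of_notin ?addNr ?(deps_notin_leads ci).
by rewrite reparam_gamma2_notin //= theta2_of_notin.
Qed.

Lemma sqnorm_params_lift (g : reduced_params R N r G) :
  sqnorm_params (lift g) = Omega Rm g.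
Proof.
rewrite sqnorm_params_reparam reparam_lift big1 ?addr0 // => i _.
rewrite big1 // => c ci; rewrite lift_sum_group (lift_theta1_group _ ci) subrr.
by apply/eqP; rewrite sqnorm_eq0.
Qed.

End Reparametrization.

Theorem theorem5p2 (R : realType) (V : finType) (categorical : pred V)
    (N : V -> nat)
    (N_continuous : forall v, ~~ categorical v -> N v = 1%N)
    (D : seq (input R N * R))
    (D_nonempty : D != [::])
    (D_onehot : forall d, d \in D -> forall v, categorical v ->
       exists j : 'I_(N v), d.1 v = delta_mx j 0)
    (lambda : R) (lambda_ge0 : 0 <= lambda)
    (r k : nat) (G : fd_groups V k)
    (lead_categorical : forall i, categorical (lead G i))
    (Rm : forall c w : V, 'M[R]_(N c, N w))
    (Rm_lead : forall i, Rm (lead G i) (lead G i) = 1%:M)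
    (Rm_fd : forall i c, c \in deps G i -> forall d, d \in D ->
       d.1 c = Rm c (lead G i) *m d.1 (lead G i)) :
  equivalent_minimization (@J R V N r lambda D)
    (@Jbar R V N r lambda D k G Rm) (@reparam R V N r k G Rm)
    (label_energy D).
Proof.
(* Predictions agree on the data, so only the regularizers can differ along a fibre. *)
have JE t : J lambda D t
    = Jbar lambda D Rm (reparam G Rm t) + label_energy D
      + lambda / 2 * (sqnorm_params t - Omega Rm (reparam G Rm t)).
  rewrite JbarE -addrA -mulrDr subrKC /J; congr (_ * _ + _).
  apply: eq_big_seq => d dD; rewrite (fm_predict_reparam (G := G) Rm_lead) //.
    by move=> i; apply: D_onehot.
  by move=> i c ci; apply: Rm_fd.
apply: equivalent_minimization_fiberwise => [t|g].
  rewrite JE lerDl mulr_ge0 ?divr_ge0 // (sqnorm_params_reparam Rm_lead).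
  rewrite addrC addKr; do 2![apply: sumr_ge0 => ? _]; exact: sqnorm_ge0.
(* At the least-norm preimage the regularizers coincide and the bound is attained. *)
exists (lift Rm g); first exact: reparam_lift.
by rewrite JE reparam_lift // sqnorm_params_lift // subrr mulr0 addr0.
Qed.
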